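(* Let $u\in X$ be the unique solution of $A(u,v)=0$ for all $v\in X$, let $u_h^0\in X_h$ be an arbitrary initial guess, and let $u_h^n\in X_h$, $n\ge 1$, be the iterates defined by $$(u_h^{n},v)_X=(u_h^{n-1},v)_X-\frac{c_0}{L^2}A(u_h^{n-1},v)\qquad\forall v\in X_h .$$ For $n\ge1$ let $\widetilde u^n\in X$ be the solution of $$(\widetilde u^{n},v)_X=(u_h^{n-1},v)_X-\frac{c_0}{L^2}A(u_h^{n-1},v)\qquad\forall v\in X,$$ and suppose that $\eta(u_h^n,X_h)$ is a quantity satisfying $\|\widetilde u^n-u_h^n\|_X\le\eta(u_h^n,X_h)$ for $n\ge 1$. Then, for $n\ge 1$, the error $e_h^n=u-u_h^n$ satisfies $$\|e_h^n\|_X\le \frac{L}{c_0}\left(1+\frac{L}{c_0}\right)\|u_h^n-u_h^{n-1}\|_X+\frac{L^2}{c_0^2}\,\eta(u_h^n,X_h).$$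
   Context: $X$ is a real Hilbert space with inner product $(\cdot,\cdot)_X$ and induced norm $\|\cdot\|_X$. $X_h\subseteq X$ is a finite dimensional linear subspace. $A:X\times X\to\mathbb{R}$ is a (possibly nonlinear) form such that for any $u\in X$ the mapping $v\mapsto A(u,v)$ is linear and bounded. It is assumed that there are constants $c_0>0$ and $L>0$ with (strong monotonicity) $A(u,u-v)-A(v,u-v)\ge c_0\|u-v\|_X^2$ for all $u,v\in X$, and (Lipschitz continuity) $|A(u,w)-A(v,w)|\le L\|u-v\|_X\|w\|_X$ for all $u,v,w\in X$. Under these assumptions there is a unique $u\in X$ with $A(u,v)=0$ for all $v\in X$. *)

(* Defs.v *)
From mathcomp Require Export all_boot all_order all_algebra.
From mathcomp Require Export all_classical all_reals all_analysis.
Export Order.TTheory GRing.Theory Num.Theory numFieldNormedType.Exports.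

Set Implicit Arguments.
Unset Strict Implicit.
Unset Printing Implicit Defensive.

Local Open Scope ring_scope.

(* The ambient space need not be a vectType, so {vspace X} is not available:
   a linear subspace is a submodClosed predicate, and it is finite dimensional
   when finitely many of its elements span it. *)
Definition finite_dimensional (R : realType) (X : lmodType R)
    (S : submodClosed X) : Prop :=
  exists (m : nat) (e : 'I_m -> X),
    (forall i, e i \in S) /\
    (forall x, x \in S -> exists c : 'I_m -> R, x = \sum_(i < m) c i *: e i).

(* Main.v *)
Require Import Defs.
From mathcomp Require Import all_boot all_order all_algebra.
From mathcomp Require Import all_classical all_reals all_analysis.
From mathcomp Require Import ring lra.
Local Open Scope ring_scope.

(** Write [alpha = c0 / L ^+ 2] for the damping parameter and [p], [w] for two
    consecutive discrete iterates, and let [t] be the step from [p] computed in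
    all of [X].  The defining equation of [t] says that [(p - t) / alpha] is
    the Riesz representative of the residual [A p], so a residual tested
    against any direction is controlled by the step length [`|t - p|].
    Testing with the error [e = u - w] itself, strong monotonicity gives
    [c0 * `|e| ^+ 2 <= A u e - A w e = - A w e], and the residual at [w] differs
    from the one at [p] by at most [L * `|w - p| * `|e|].  Cancelling one factor
    [`|e|] yields
    [c0 * `|e| <= alpha^-1 * `|t - p| + L * `|w - p|]
    ([error_le_full_step]).  It remains to split [t - p] through [w]: the part
    [t - w] is bounded by [eta], the part [w - p] is the discrete increment, and
    dividing by [c0] produces the stated constants. *)

Lemma dot_sqr_norm {R : realType} {X : normedModType R}
    {ip : {dot X for idfun}} :
    (forall x : X, `|x| = Num.sqrt (ip x x)) ->
  forall x : X, ip x x = `|x| ^+ 2.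
Proof.
move=> norm_ip x; rewrite norm_ip sqr_sqrtr//.
have [->|x0] := eqVneq x 0; first by rewrite linear0l.
exact/ltW/neq0_dnorm_gt0.
Qed.

(** Cauchy-Schwarz inequality.  The square root of [ip x x] is already known to
    be a norm, so the inequality can be read off from the triangle inequality
    [`|x + y| ^+ 2 <= (`|x| + `|y|) ^+ 2] by expanding both sides. *)
Lemma dot_le_norm {R : realType} {X : normedModType R}
    {ip : {dot X for idfun}} :
    (forall x : X, `|x| = Num.sqrt (ip x x)) ->
  forall x y : X, ip x y <= `|x| * `|y|.
Proof.
move=> norm_ip x y.
have ip_sym : ip y x = ip x y.
  by rewrite [LHS](hermC ip) expr0 mul1r.
have tri : `|x + y| ^+ 2 <= (`|x| + `|y|) ^+ 2.
  by rewrite lerXn2r ?nnegrE ?addr_ge0// ler_normD.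
move: tri; rewrite -(dot_sqr_norm norm_ip) linearDl !linearDr/= ip_sym.
rewrite !(dot_sqr_norm norm_ip); nra.
Qed.

(** A posteriori bound: the right-hand side does not mention [u].  Continuity
    moves the residual from [w] to [p], where the equation of [t] turns it into
    an inner product, to be estimated by Cauchy-Schwarz. *)
Lemma error_le_full_step {R : realType} {X : normedModType R}
    {ip : {dot X for idfun}} {A : X -> X -> R}
    {c0 L alpha : R} {u p} w {t : X} :
    (forall x : X, `|x| = Num.sqrt (ip x x)) ->
    0 <= L -> 0 < alpha ->
    (forall x y : X, A x (x - y) - A y (x - y) >= c0 * `|x - y| ^+ 2) ->
    (forall x y v : X, `|A x v - A y v| <= L * `|x - y| * `|v|) ->
    (forall v : X, A u v = 0) ->
    (forall v : X, ip t v = ip p v - alpha * A p v) ->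
  c0 * `|u - w| <= alpha^-1 * `|t - p| + L * `|w - p|.
Proof.
move=> norm_ip L_ge0 alpha_gt0 A_mono A_lip u_sol t_step.
set e := u - w.
(* The factor [`|e|] is cancelled at the end, so [e = 0] is treated apart. *)
have [->|e_neq0] := eqVneq e 0.
  by rewrite normr0 mulr0 addr_ge0// mulr_ge0// invr_ge0 ltW.
have e_gt0 : 0 < `|e| by rewrite normr_gt0.
have residual : - A p e <= alpha^-1 * (`|t - p| * `|e|).
  have -> : - A p e = alpha^-1 * ip (t - p) e.
    by rewrite linearBl/= t_step; field; rewrite gt_eqF.
  by rewrite ler_pM2l ?invr_gt0// dot_le_norm.
have mono : c0 * `|e| ^+ 2 <= - A w e.
  by have := A_mono u w; rewrite u_sol sub0r.
have lip : A p e - A w e <= L * `|w - p| * `|e|.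
  by rewrite distrC; exact: le_trans (ler_norm _) (A_lip _ _ _).
rewrite -(ler_pM2r e_gt0); lra.
Qed.

Theorem proposition2p5
  (R : realType) (X : completeNormedModType R)
  (ip : {dot X for idfun})
  (norm_ip : forall x : X, `|x| = Num.sqrt (ip x x))
  (Xh : submodClosed X) (Xh_fin : finite_dimensional Xh)
  (A : X -> X -> R)
  (A_linear : forall u : X, scalar (A u))
  (A_bounded : forall u : X, exists M : R, forall v : X, `|A u v| <= M * `|v|)
  (c0 L : R) (c0_gt0 : 0 < c0) (L_gt0 : 0 < L)
  (A_monotone : forall u v : X,
    A u (u - v) - A v (u - v) >= c0 * `|u - v| ^+ 2)
  (A_lipschitz : forall u v w : X,
    `|A u w - A v w| <= L * `|u - v| * `|w|)
  (u : X) (u_sol : forall v : X, A u v = 0)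
  (uh : nat -> X) (uh_in : forall n : nat, uh n \in Xh)
  (uh_iter : forall n : nat, (1 <= n)%N -> forall v : X, v \in Xh ->
    ip (uh n) v = ip (uh n.-1) v - c0 / L ^+ 2 * A (uh n.-1) v)
  (ut : nat -> X)
  (ut_sol : forall n : nat, (1 <= n)%N -> forall v : X,
    ip (ut n) v = ip (uh n.-1) v - c0 / L ^+ 2 * A (uh n.-1) v)
  (eta : nat -> R)
  (eta_bound : forall n : nat, (1 <= n)%N -> `|ut n - uh n| <= eta n) :
  forall n : nat, (1 <= n)%N ->
    `|u - uh n| <= L / c0 * (1 + L / c0) * `|uh n - uh n.-1|
                   + L ^+ 2 / c0 ^+ 2 * eta n.
Proof.
move=> n n_ge1.
have alpha_gt0 : 0 < c0 / L ^+ 2 by rewrite divr_gt0 ?exprn_gt0.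
have err := error_le_full_step (uh n) norm_ip (ltW L_gt0) alpha_gt0
  A_monotone A_lipschitz u_sol (ut_sol n n_ge1).
have step : `|ut n - uh n.-1| <= eta n + `|uh n - uh n.-1|.
  apply: le_trans (ler_distD (uh n) _ _) _.
  by rewrite lerD2r eta_bound.
rewrite -(ler_pM2l c0_gt0); apply: le_trans err _.
have -> : c0 * (L / c0 * (1 + L / c0) * `|uh n - uh n.-1|
            + L ^+ 2 / c0 ^+ 2 * eta n) =
          (c0 / L ^+ 2)^-1 * (eta n + `|uh n - uh n.-1|)
            + L * `|uh n - uh n.-1|.
  by field; rewrite !gt_eqF.
by rewrite lerD2r ler_pM2l ?invr_gt0.
Qed.
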